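(* Suppose that a fibration $p\colon\mathbb{E}\to\mathbb{B}$ is locally small and $\mathbb{B}$ has all finite limits. Then the universal family of lifting problems from $m$ to $f$ exists for any vertical maps $m$ and $f$ of $\mathbb{E}$.
   Context: $p$ is a cloven Grothendieck fibration with reindexing $\sigma^*$. A map is vertical over $I$ if $p$ sends it to $1_I$; $\mathbb{E}_I$ is the fibre category. $V(\mathbb{E})$ is the full subcategory of $\mathbb{E}^{\mathbf 2}$ on vertical maps, fibred over $\mathbb{B}$ by $p\circ\mathrm{dom}=p\circ\mathrm{cod}$ with levelwise reindexing. $p$ is locally small if there is a choice, for all $I$ and $X,Y\in\mathbb{E}_I$, of an object $\underline{\mathrm{Hom}}_I(X,Y)\to I$ of $\mathbb{B}/I$ representing the functor $(\mathbb{B}/I)^{op}\to\mathbf{Set}$, $(u\colon J\to I)\mapsto\mathbb{E}_J(u^*X,u^*Y)$. Let $m$ be vertical over $I$ and $f$ vertical over $J$. A family of lifting problems from $m$ to $f$ over $K\in\mathbb{B}$ consists of $\sigma\colon K\to I$, $\tau\colon K\to J$ and a commutative square in $\mathbb{E}_K$ with left side $\sigma^*(m)$ and right side $\tau^*(f)$; equivalently a morphism $h\colon\sigma^*(m)\to f$ of $V(\mathbb{E})$ over $\tau$. The universal family of lifting problems from $m$ to $f$ is the one given by the hom object $\underline{\mathrm{Hom}}(m,f)$ in $V(\mathbb{E})\to\mathbb{B}$, that is, a family $(\underline{\mathrm{Hom}}(m,f),\sigma,\tau,h)$ such that for every family $(K',\sigma',\tau',h')$ of lifting problems from $m$ to $f$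 there is a unique $t\colon K'\to\underline{\mathrm{Hom}}(m,f)$ with $\sigma t=\sigma'$, $\tau t=\tau'$ and $h'=h\circ c$, where $c\colon\sigma'^*(m)\to\sigma^*(m)$ is the canonical cartesian map over $t$. *)

(* Defs.v *)
From Stdlib Require Import FinFun ClassicalEpsilon FunctionalExtensionality ProofIrrelevance.

Set Implicit Arguments.
Unset Strict Implicit.

Declare Scope cat_scope.
Open Scope cat_scope.

Record Category := {
  Ob :> Type;
  Hom : Ob -> Ob -> Type;
  id : forall x, Hom x x;
  comp : forall x y z, Hom y z -> Hom x y -> Hom x z;
  id_l : forall x y (f : Hom x y), comp (id y) f = f;
  id_r : forall x y (f : Hom x y), comp f (id x) = f;
  comp_assoc : forall w x y z (h : Hom y z) (g : Hom x y) (f : Hom w x),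
    comp h (comp g f) = comp (comp h g) f
}.
Arguments Hom {c} x y.
Arguments id {c} x.
Arguments comp {c x y z} g f.
Notation "g 'o' f" := (comp g f) (at level 40, left associativity) : cat_scope.

Record Functor (C D : Category) := {
  fob :> C -> D;
  fmap : forall x y : C, Hom x y -> Hom (fob x) (fob y);
  fmap_id : forall x : C, fmap (id x) = id (fob x);
  fmap_comp : forall (x y z : C) (g : Hom y z) (f : Hom x y),
    fmap (g o f) = fmap g o fmap f
}.
Arguments fmap {C D} F {x y} f : rename.

Record NatIso (C D : Category) (F G : Functor C D) := {
  nat_fwd : forall x : C, Hom (F x) (G x);
  nat_bwd : forall x : C, Hom (G x) (F x);
  nat_fwd_bwd : forall x : C, nat_fwd x o nat_bwd x = id (G x);
  nat_bwd_fwd : forall x : C, nat_bwd x o nat_fwd x = id (F x);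
  nat_square : forall (x y : C) (f : Hom x y),
    nat_fwd y o fmap F f = fmap G f o nat_fwd x
}.

Definition Op (C : Category) : Category.
Proof.
  refine {| Ob := Ob C; Hom := fun x y => @Hom C y x; id := fun x => @id C x;
            comp := fun x y z g f => @comp C z y x f g |}; intros.
  - apply id_r.
  - apply id_l.
  - symmetry; apply comp_assoc.
Defined.

Definition TypeCat : Category.
Proof.
  refine {| Ob := Type; Hom := fun A B => A -> B; id := fun A a => a;
            comp := fun A B C g f a => g (f a) |}; reflexivity.
Defined.

Definition Presheaf (C : Category) := Functor (Op C) TypeCat.

Definition yoneda (C : Category) (c : C) : Presheaf C.
Proof.
  refine {| fob := fun x : Op C => (@Hom C x c : TypeCat);
            fmap := fun (x y : Op C) (f : @Hom (Op C) x y) (g : @Hom C x c) =>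
                      @comp C y x c g f |}; intros; apply functional_extensionality.
  - intro g; apply (@id_r C).
  - intro h; apply (@comp_assoc C).
Defined.

Record Representation (C : Category) (F : Presheaf C) := {
  rep_ob : C;
  rep_iso : NatIso (yoneda rep_ob) F
}.

Lemma sig_ext (A : Type) (P : A -> Prop) (x y : {a : A | P a}) :
  proj1_sig x = proj1_sig y -> x = y.
Proof. apply eq_sig_hprop; intros; apply proof_irrelevance. Qed.

Definition Slice (B : Category) (I : B) : Category.
Proof.
  refine {| Ob := {J : B & Hom J I};
            Hom := fun u v => {t : Hom (projT1 u) (projT1 v) | projT2 v o t = projT2 u};
            id := fun u => exist _ (id (projT1 u)) (id_r _);
            comp := fun u v w s t => exist _ (proj1_sig s o proj1_sig t) _ |};
    try (intros; apply sig_ext; simpl).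
  - apply id_l.
  - apply id_r.
  - apply comp_assoc.
  Unshelve.
  abstract (now rewrite comp_assoc, (proj2_sig s), (proj2_sig t)).
Defined.

Definition FullSub (C : Category) (P : C -> Prop) : Category.
Proof.
  refine {| Ob := {x : C | P x};
            Hom := fun x y => Hom (proj1_sig x) (proj1_sig y);
            id := fun x => id (proj1_sig x);
            comp := fun x y z g f => g o f |}; intros.
  - apply id_l.
  - apply id_r.
  - apply comp_assoc.
Defined.

Record ArrOb (C : Category) := { src : C; tgt : C; arr : Hom src tgt }.

Record ArrHom (C : Category) (m n : ArrOb C) := {
  hsrc : Hom (src m) (src n);
  htgt : Hom (tgt m) (tgt n);
  hsq : arr n o hsrc = htgt o arr m
}.

Lemma ArrHom_ext (C : Category) (m n : ArrOb C) (h k : ArrHom m n) :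
  hsrc h = hsrc k -> htgt h = htgt k -> h = k.
Proof.
  destruct h, k; simpl; intros; subst; f_equal; apply proof_irrelevance.
Qed.

Definition Arr (C : Category) : Category.
Proof.
  refine {| Ob := ArrOb C; Hom := @ArrHom C;
            id := fun m => {| hsrc := id (src m); htgt := id (tgt m); hsq := _ |};
            comp := fun m n q k h =>
              {| hsrc := hsrc k o hsrc h; htgt := htgt k o htgt h; hsq := _ |} |};
    try (intros; apply ArrHom_ext; simpl;
         (apply id_l || apply id_r || apply comp_assoc)).
  Unshelve.
  - abstract (now rewrite id_l, id_r).
  - abstract (now rewrite comp_assoc, (hsq k), <- comp_assoc, (hsq h), comp_assoc).
Defined.

Definition FiniteCategory (D : Category) : Prop :=
  Finite D /\ forall x y : D, Finite (Hom x y).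

Record Cone (D C : Category) (F : Functor D C) := {
  apex : C;
  leg : forall d : D, Hom apex (F d);
  leg_natural : forall (d e : D) (a : Hom d e), fmap F a o leg d = leg e
}.

Definition is_limit (D C : Category) (F : Functor D C) (L : Cone F) : Prop :=
  forall L' : Cone F, exists! t : Hom (apex L') (apex L),
    forall d : D, leg L d o t = leg L' d.

Definition has_finite_limits (C : Category) : Prop :=
  forall (D : Category) (F : Functor D C), FiniteCategory D -> exists L : Cone F, is_limit L.

(* Fibres of a functor p are taken strictly: an object over I is an X with a proof of
   p X = I, and a map X -> Y lies over u : I -> J when p f = u after transport along
   these two equalities. *)
Definition hom_cast (C : Category) (x x' y y' : C) (ex : x = x') (ey : y = y') :
  Hom x y -> Hom x' y' :=
  match ex in _ = a, ey in _ = b return Hom x y -> Hom a b with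
  | eq_refl, eq_refl => fun f => f
  end.

Record FibOb (E B : Category) (p : Functor E B) (I : B) := {
  total : E;
  total_eq : p total = I
}.
Coercion total : FibOb >-> Ob.

Definition over (E B : Category) (p : Functor E B) (I J : B)
  (X : FibOb p I) (Y : FibOb p J) (u : Hom I J) (f : Hom (total X) (total Y)) : Prop :=
  hom_cast (total_eq X) (total_eq Y) (fmap p f) = u.

Lemma over_id (E B : Category) (p : Functor E B) (I : B) (X : FibOb p I) :
  over (X := X) (Y := X) (id I) (id (total X)).
Proof. destruct X as [X []]; apply fmap_id. Qed.

Lemma over_comp (E B : Category) (p : Functor E B) (I J K : B)
  (X : FibOb p I) (Y : FibOb p J) (Z : FibOb p K) (v : Hom J K) (u : Hom I J)
  (g : Hom (total Y) (total Z)) (f : Hom (total X) (total Y)) :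
  over v g -> over u f -> over (X := X) (Y := Z) (v o u) (g o f).
Proof.
  destruct X as [X eX], Y as [Y eY], Z as [Z eZ]; unfold over; simpl in *.
  intros <- <-; subst; apply fmap_comp.
Qed.

Lemma over_vert_l (E B : Category) (p : Functor E B) (I J : B)
  (X : FibOb p I) (Y Z : FibOb p J) (u : Hom I J)
  (g : Hom (total Y) (total Z)) (f : Hom (total X) (total Y)) :
  over (id J) g -> over u f -> over (X := X) (Y := Z) u (g o f).
Proof.
  intros Hg Hf; pose proof (over_comp Hg Hf) as H; now rewrite id_l in H.
Qed.

Lemma over_vert_r (E B : Category) (p : Functor E B) (I J : B)
  (X Y : FibOb p I) (Z : FibOb p J) (u : Hom I J)
  (g : Hom (total Y) (total Z)) (f : Hom (total X) (total Y)) :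
  over u g -> over (id I) f -> over (X := X) (Y := Z) u (g o f).
Proof.
  intros Hg Hf; pose proof (over_comp Hg Hf) as H; now rewrite id_r in H.
Qed.

Lemma over_of_fmap (E B : Category) (p : Functor E B) (I J : B)
  (X : FibOb p I) (Y : FibOb p J) (u : Hom I J) (l : Hom (total X) (total Y))
  (Z : E) (g : Hom Z (total Y)) (w : Hom (p Z) (p (total X))) :
  over u l -> fmap p l o w = fmap p g ->
  over (X := Build_FibOb (eq_refl (p Z))) (Y := Y)
    (u o hom_cast eq_refl (total_eq X) w) g.
Proof.
  destruct X as [X eX], Y as [Y eY]; unfold over; simpl in *.
  intros <- H; subst; simpl; now symmetry.
Qed.

Lemma over_cast (E B : Category) (p : Functor E B) (I : B) (X : FibOb p I)
  (Z : E) (h : Hom Z (total X)) (w : Hom (p Z) (p (total X))) :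
  over (X := Build_FibOb (eq_refl (p Z))) (Y := X) (hom_cast eq_refl (total_eq X) w) h
  <-> fmap p h = w.
Proof.
  destruct X as [X eX]; unfold over; simpl in *; subst; simpl; tauto.
Qed.

Definition is_cartesian (E B : Category) (p : Functor E B) (X Y : E) (f : Hom X Y) : Prop :=
  forall (Z : E) (g : Hom Z Y) (w : Hom (p Z) (p X)), fmap p f o w = fmap p g ->
    exists! h : Hom Z X, fmap p h = w /\ f o h = g.

Record Cleavage (E B : Category) (p : Functor E B) := {
  reindex : forall I J : B, Hom I J -> FibOb p J -> FibOb p I;
  lift : forall (I J : B) (u : Hom I J) (Y : FibOb p J),
    Hom (total (reindex u Y)) (total Y);
  lift_over : forall (I J : B) (u : Hom I J) (Y : FibOb p J), over u (lift u Y);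
  lift_cartesian : forall (I J : B) (u : Hom I J) (Y : FibOb p J),
    is_cartesian p (lift u Y)
}.

Arguments lift_over {E B p} c {I J} u Y.
Arguments lift_cartesian {E B p} c {I J} u Y.

Section Fibration.

Variables (E B : Category) (p : Functor E B) (cl : Cleavage p).

Lemma factor_exists (I J K : B) (u : Hom J I) (Y : FibOb p I) (t : Hom K J)
  (Z : FibOb p K) (g : Hom (total Z) (total Y)) (Hg : over (u o t) g) :
  exists! h : Hom (total Z) (total (reindex cl u Y)),
    over t h /\ lift cl u Y o h = g.
Proof.
  pose proof (lift_over cl u Y) as Ho.
  pose proof (lift_cartesian cl u Y) as Hc.
  revert Ho Hc; generalize (lift cl u Y).
  destruct (reindex cl u Y) as [X eX]; simpl; intros l Ho Hc.
  destruct Y as [Y eY], Z as [Z eZ]; unfold over in *; simpl in *.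
  subst; simpl in *; apply Hc; now rewrite Hg.
Qed.

Definition factor (I J K : B) (u : Hom J I) (Y : FibOb p I) (t : Hom K J)
  (Z : FibOb p K) (g : Hom (total Z) (total Y)) (Hg : over (u o t) g) :
  Hom (total Z) (total (reindex cl u Y)) :=
  proj1_sig (constructive_definite_description _ (factor_exists Hg)).

Lemma factor_over (I J K : B) (u : Hom J I) (Y : FibOb p I) (t : Hom K J)
  (Z : FibOb p K) (g : Hom (total Z) (total Y)) (Hg : over (u o t) g) :
  over t (factor Hg).
Proof.
  unfold factor; now destruct (constructive_definite_description _ (factor_exists Hg)).
Qed.

Lemma lift_factor (I J K : B) (u : Hom J I) (Y : FibOb p I) (t : Hom K J)
  (Z : FibOb p K) (g : Hom (total Z) (total Y)) (Hg : over (u o t) g) :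
  lift cl u Y o factor Hg = g.
Proof.
  unfold factor; now destruct (constructive_definite_description _ (factor_exists Hg)).
Qed.

Lemma lift_cancel (I J K : B) (u : Hom J I) (Y : FibOb p I) (t : Hom K J)
  (Z : FibOb p K) (h k : Hom (total Z) (total (reindex cl u Y))) :
  over t h -> over t k -> lift cl u Y o h = lift cl u Y o k -> h = k.
Proof.
  intros Hh Hk e.
  assert (Hg : over (X := Z) (Y := Y) (u o t) (lift cl u Y o k))
    by (eapply over_comp; [apply lift_over | exact Hk]).
  destruct (factor_exists Hg) as [a [_ Ha]].
  transitivity a; [symmetry|]; now apply Ha.
Qed.

Definition Fibre (I : B) : Category.
Proof.
  refine {| Ob := FibOb p I;
            Hom := fun X Y => {f : Hom (total X) (total Y) | over (X := X) (Y := Y) (id I) f};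
            id := fun X => exist _ (id (total X)) (over_id X);
            comp := fun X Y Z g f => exist _ (proj1_sig g o proj1_sig f) _ |};
    try (intros; apply sig_ext; simpl).
  - apply id_l.
  - apply id_r.
  - apply comp_assoc.
  Unshelve.
  exact (over_vert_l (proj2_sig g) (proj2_sig f)).
Defined.

Lemma canon_over (I J K : B) (s : Hom J I) (t : Hom K J) (s' : Hom K I)
  (e : s o t = s') (X : FibOb p I) : over (s o t) (lift cl s' X).
Proof. rewrite e; apply lift_over. Qed.

(* The canonical cartesian map s'^*X -> s^*X over t, for s t = s'. *)
Definition canon (I J K : B) (s : Hom J I) (t : Hom K J) (s' : Hom K I)
  (e : s o t = s') (X : FibOb p I) :
  Hom (total (reindex cl s' X)) (total (reindex cl s X)) :=
  factor (canon_over e X).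

Lemma pull_over (I J K : B) (X Y : FibOb p I) (u : Hom J I) (t : Hom K J) (u' : Hom K I)
  (e : u o t = u')
  (g : @Hom (Fibre J) (reindex cl u X) (reindex cl u Y)) :
  over (X := reindex cl u' X) (Y := Y) (u' o id K)
    (lift cl u Y o (proj1_sig g o canon e X)).
Proof.
  rewrite id_r, <- e; apply over_comp with (Y := reindex cl u Y).
  - apply lift_over.
  - apply over_vert_l with (Y := reindex cl u X).
    + exact (proj2_sig g).
    + apply factor_over.
Qed.

(* Reindexing g : u^*X -> u^*Y along t, composed with the canonical isomorphisms
   (u t)^* = t^* u^*: the vertical map g' : u'^*X -> u'^*Y characterised by
   canon Y o g' = g o canon X (see [pull_spec]). *)
Definition pull (I J K : B) (X Y : FibOb p I) (u : Hom J I) (t : Hom K J) (u' : Hom K I)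
  (e : u o t = u')
  (g : @Hom (Fibre J) (reindex cl u X) (reindex cl u Y)) :
  @Hom (Fibre K) (reindex cl u' X) (reindex cl u' Y) :=
  exist _ (factor (pull_over e g)) (factor_over (pull_over e g)).

Lemma pull_spec (I J K : B) (X Y : FibOb p I) (u : Hom J I) (t : Hom K J) (u' : Hom K I)
  (e : u o t = u')
  (g : @Hom (Fibre J) (reindex cl u X) (reindex cl u Y)) :
  canon e Y o proj1_sig (pull e g) = proj1_sig g o canon e X.
Proof.
  apply lift_cancel with (t := t).
  - eapply over_vert_r; apply factor_over.
  - eapply over_vert_l; [exact (proj2_sig g) | apply factor_over].
  - rewrite comp_assoc; unfold canon at 1; rewrite lift_factor; apply lift_factor.
Qed.

Lemma pull_unique (I J K : B) (X Y : FibOb p I) (u : Hom J I) (t : Hom K J) (u' : Hom K I)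
  (e : u o t = u')
  (g : @Hom (Fibre J) (reindex cl u X) (reindex cl u Y))
  (g' : @Hom (Fibre K) (reindex cl u' X) (reindex cl u' Y)) :
  canon e Y o proj1_sig g' = proj1_sig g o canon e X -> pull e g = g'.
Proof.
  intro H; apply sig_ext; apply lift_cancel with (t := id K).
  - exact (proj2_sig (pull e g)).
  - exact (proj2_sig g').
  - replace (lift cl u' Y) with (lift cl u Y o canon e Y) by apply lift_factor.
    rewrite <- !comp_assoc; f_equal; rewrite H; apply pull_spec.
Qed.

Lemma canon_id (I J : B) (u : Hom J I) (e : u o id J = u) (X : FibOb p I) :
  canon e X = id _.
Proof.
  apply lift_cancel with (t := id J).
  - apply factor_over.
  - apply over_id.
  - rewrite id_r; apply lift_factor.
Qed.

Lemma canon_comp (I J K L : B) (u : Hom J I) (t : Hom K J) (u' : Hom K I)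
  (t' : Hom L K) (u'' : Hom L I) (e : u o t = u') (e' : u' o t' = u'')
  (e'' : u o (t o t') = u'') (X : FibOb p I) :
  canon e'' X = canon e X o canon e' X.
Proof.
  apply lift_cancel with (t := t o t').
  - apply factor_over.
  - eapply over_comp; apply factor_over.
  - rewrite comp_assoc; unfold canon; now rewrite !lift_factor.
Qed.

(* The functor (B/I)^op -> Set sending u : J -> I to E_J(u^*X, u^*Y). *)
Definition HomPresheaf (I : B) (X Y : FibOb p I) : Presheaf (Slice I).
Proof.
  refine {| fob := fun u : Op (Slice I) =>
              (@Hom (Fibre (projT1 u)) (reindex cl (projT2 u) X) (reindex cl (projT2 u) Y)
               : TypeCat);
            fmap := fun u v t g => pull (proj2_sig t) g |}.
  - intros u; apply functional_extensionality; intro g; apply pull_unique.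
    rewrite !canon_id, id_l; symmetry; apply id_r.
  - intros u v w s t; apply functional_extensionality; intro g; apply pull_unique.
    pose (st := @comp (Op (Slice I)) u v w s t).
    change (canon (proj2_sig st) Y o
              proj1_sig (pull (proj2_sig s) (pull (proj2_sig t) g)) =
            proj1_sig g o canon (proj2_sig st) X).
    rewrite !(canon_comp (proj2_sig t) (proj2_sig s)), <- comp_assoc, pull_spec.
    rewrite !comp_assoc, pull_spec; reflexivity.
Defined.

Definition LocallySmall : Type :=
  forall (I : B) (X Y : FibOb p I), Representation (HomPresheaf X Y).

(* p m = 1, the base being p (src m); thus an object over I of the projection
   [vert_proj] below (p o dom) is exactly a map of E vertical over I. *)
Definition is_vertical (m : Arr E) : Prop :=
  exists e : p (tgt m) = p (src m),
    hom_cast eq_refl e (fmap p (arr m)) = id (p (src m)).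

Definition Vert : Category := FullSub is_vertical.

Definition vert_proj : Functor Vert B.
Proof.
  refine {| fob := fun m : Vert => p (src (proj1_sig m));
            fmap := fun (m n : Vert) (h : Hom m n) => fmap p (hsrc h) |}; intros; simpl.
  - apply fmap_id.
  - apply fmap_comp.
Defined.

Lemma vertical_tgt (I : B) (m : FibOb vert_proj I) : p (tgt (proj1_sig (total m))) = I.
Proof.
  destruct m as [[m [e He]] []]; exact e.
Qed.

Definition vsrc (I : B) (m : FibOb vert_proj I) : FibOb p I :=
  {| total := src (proj1_sig (total m)); total_eq := total_eq m |}.

Definition vtgt (I : B) (m : FibOb vert_proj I) : FibOb p I :=
  {| total := tgt (proj1_sig (total m)); total_eq := vertical_tgt m |}.

Definition varr (I : B) (m : FibOb vert_proj I) : Hom (total (vsrc m)) (total (vtgt m)) :=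
  arr (proj1_sig (total m)).

Lemma varr_over (I : B) (m : FibOb vert_proj I) : over (id I) (varr m).
Proof.
  unfold over, vsrc, vtgt, varr; simpl.
  generalize (vertical_tgt m); destruct m as [[m [e He]] []]; simpl; intro e'.
  now rewrite (proof_irrelevance _ e' e).
Qed.

Lemma over_vertical (I : B) (X Y : FibOb p I) (m : Hom (total X) (total Y)) :
  over (id I) m -> is_vertical {| arr := m |}.
Proof.
  destruct X as [X eX], Y as [Y eY]; unfold over, is_vertical; simpl in *; intro H.
  subst; now exists eY.
Qed.

Definition mk_vert (I : B) (X Y : FibOb p I) (m : Hom (total X) (total Y))
  (Hm : over (id I) m) : FibOb vert_proj I :=
  Build_FibOb (p := vert_proj)
    (total := exist _ {| arr := m |} (over_vertical Hm)) (total_eq X).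

Lemma vreindex_over (I J : B) (u : Hom I J) (m : FibOb vert_proj J) :
  over (X := reindex cl u (vsrc m)) (Y := vtgt m) (u o id I)
    (varr m o lift cl u (vsrc m)).
Proof.
  rewrite id_r; eapply over_vert_l; [apply varr_over | apply lift_over].
Qed.

(* u^*m : u^*(dom m) -> u^*(cod m), the vertical map commuting with the lifts of u. *)
Definition vreindex (I J : B) (u : Hom I J) (m : FibOb vert_proj J) : FibOb vert_proj I :=
  mk_vert (factor_over (vreindex_over u m)).

Definition vlift (I J : B) (u : Hom I J) (m : FibOb vert_proj J) :
  Hom (total (vreindex u m)) (total m).
Proof.
  refine {| hsrc := lift cl u (vsrc m) : Hom (src (proj1_sig (total (vreindex u m)))) _;
            htgt := lift cl u (vtgt m) : Hom (tgt (proj1_sig (total (vreindex u m)))) _ |}.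
  abstract (symmetry; exact (lift_factor (vreindex_over u m))).
Defined.

Lemma vert_hom_over (I J : B) (m : FibOb vert_proj I) (n : FibOb vert_proj J)
  (u : Hom I J) (h : Hom (total m) (total n)) :
  over u h -> over (X := vtgt m) (Y := vtgt n) u (htgt h).
Proof.
  intro H.
  assert (H1 : over (X := vsrc m) (Y := vtgt n) (id J o u) (varr n o hsrc h))
    by (eapply over_comp; [apply varr_over | exact H]).
  replace (varr n o hsrc h) with (htgt h o varr m) in H1 by (symmetry; apply (hsq h)).
  assert (H2 : over (X := vsrc m) (Y := vtgt n)
                 (hom_cast (total_eq (vtgt m)) (total_eq (vtgt n)) (fmap p (htgt h)) o id I)
                 (htgt h o varr m))
    by (apply over_comp with (Y := vtgt m); [reflexivity | apply varr_over]).
  unfold over in H1, H2; rewrite H1, id_l, id_r in H2; symmetry; exact H2.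
Qed.

Lemma vlift_cartesian (I J : B) (u : Hom I J) (m : FibOb vert_proj J) :
  is_cartesian vert_proj (vlift u m).
Proof.
  intros z g w Hw.
  set (n := {| total := z; total_eq := eq_refl |} : FibOb vert_proj (vert_proj z)).
  set (K := vert_proj z) in *.
  set (t := hom_cast eq_refl (total_eq (vreindex u m)) w : Hom K I).
  assert (Hg : over (X := n) (Y := m) (u o t) g)
    by exact (over_of_fmap (lift_over cl u (vsrc m) : over (X := vreindex u m) u (vlift u m)) Hw).
  pose proof (vert_hom_over Hg) as Hg1.
  assert (Hs : over (X := vsrc n) (Y := vsrc m) (u o t) (hsrc g)) by exact Hg.
  assert (Hsq : factor (vreindex_over u m) o factor Hs = factor Hg1 o varr n).
  { apply lift_cancel with (t := t).
    - eapply over_vert_l; apply factor_over.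
    - eapply over_vert_r; [apply factor_over | apply varr_over].
    - rewrite !comp_assoc, !lift_factor, <- comp_assoc, lift_factor.
      exact (hsq g). }
  assert (Ht : forall h : Hom (src (proj1_sig z)) (total (reindex cl u (vsrc m))),
      over (X := vsrc n) (Y := reindex cl u (vsrc m)) t h <-> fmap p h = w).
  { intro h; exact (over_cast (X := reindex cl u (vsrc m)) h w). }
  exists {| hsrc := factor Hs : Hom _ (src (proj1_sig (total (vreindex u m))));
            htgt := factor Hg1 : Hom _ (tgt (proj1_sig (total (vreindex u m))));
            hsq := Hsq |}.
  split; [split|].
  - apply Ht, factor_over.
  - apply ArrHom_ext; [exact (lift_factor Hs) | exact (lift_factor Hg1)].
  - intros h [H1 H2]; apply Ht in H1.
    assert (Hh : over (X := n) (Y := vreindex u m) t h) by exact H1.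
    apply ArrHom_ext; simpl.
    + apply (lift_cancel (u := u) (t := t) (Y := vsrc m) (Z := vsrc n));
        [apply factor_over | exact H1 |].
      now rewrite lift_factor, <- H2.
    + apply (lift_cancel (u := u) (t := t) (Y := vtgt m) (Z := vtgt n));
        [apply factor_over | |].
      { pose proof (vert_hom_over Hh) as H3; unfold over in *; simpl in *.
        now rewrite (proof_irrelevance _ _ (vertical_tgt (vreindex u m))). }
      now rewrite lift_factor, <- H2.
Qed.

Definition vert_cleavage : Cleavage vert_proj :=
  {| reindex := vreindex;
     lift := vlift;
     lift_over := fun I J u m => lift_over cl u (vsrc m);
     lift_cartesian := vlift_cartesian |}.

End Fibration.

(* The commutative square from sigma^*m to tau^*f in the fibre over K is encoded by the
   square from sigma^*m to f over tau obtained by composing with the cartesian lifts of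
   tau, i.e. by a morphism of [Vert] over tau. *)
Record LiftingFamily (E B : Category) (p : Functor E B) (cl : Cleavage p) (I J : B)
  (m : FibOb (vert_proj p) I) (f : FibOb (vert_proj p) J) := {
  lf_base : B;
  lf_left : Hom lf_base I;
  lf_right : Hom lf_base J;
  lf_map : Hom (total (reindex (vert_cleavage cl) lf_left m)) (total f);
  lf_over : over lf_right lf_map
}.

Definition is_universal_family (E B : Category) (p : Functor E B) (cl : Cleavage p)
  (I J : B) (m : FibOb (vert_proj p) I) (f : FibOb (vert_proj p) J)
  (U : LiftingFamily cl m f) : Prop :=
  forall L : LiftingFamily cl m f, exists! t : Hom (lf_base L) (lf_base U),
    exists e : lf_left U o t = lf_left L,
      lf_right U o t = lf_right L /\
      lf_map L = lf_map U o canon (vert_cleavage cl) e m.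

(* Main.v *)
Require Import Defs.
From Stdlib Require Import FinFun List ProofIrrelevance.

(** Write [U(X, Y)] for an object of the base carrying a universal pair of maps [s], [r] and a
    universal map [s^*X -> Y] over [r].  If [X] lies over [I] and [Y] over [J], it is the hom
    object of the two pullbacks of [X] and [Y] to [I * J].  A lifting problem from [m] to [f] is
    a map between the domains and a map between the codomains with equal composites
    [dom m -> cod f]; so the universal one lives on the pullback of
    [U(dom m, dom f) -> U(dom m, cod f) <- U(cod m, cod f)], the arrows being composition with
    [f] and with [m]. *)

Set Implicit Arguments.
Unset Strict Implicit.

(** * The finite index categories of binary products and pullbacks *)

Definition Pair : Category.
Proof.
  refine {| Ob := bool;
            Hom := fun x y => if Bool.eqb x y then unit else Empty_set;
            id := fun x => match x with true => tt | false => tt end;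
            comp := fun x y z => _ |}.
  Unshelve.
  4: destruct x, y, z; simpl; tauto.
  - intros [] [] []; reflexivity.
  - intros [] [] []; reflexivity.
  - intros [] [] [] [] [] [] []; reflexivity.
Defined.

Inductive cospan := left_foot | right_foot | peak.

Definition cospan_hom (x y : cospan) : Type :=
  match x, y with
  | left_foot, right_foot | right_foot, left_foot
  | peak, left_foot | peak, right_foot => Empty_set
  | _, _ => unit
  end.

Definition Cospan : Category.
Proof.
  refine {| Ob := cospan; Hom := cospan_hom;
            id := fun x => match x return cospan_hom x x with
                           | left_foot => tt | right_foot => tt | peak => tt end;
            comp := fun x y z => _ |}.
  Unshelve.
  4: destruct x, y, z; simpl; tauto.
  - intros [] [] []; reflexivity.
  - intros [] [] []; reflexivity.
  - intros [] [] [] [] [] [] []; reflexivity.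
Defined.

Lemma Finite_unit : Finite unit.
Proof. exists (tt :: nil); intros []; now left. Qed.

Lemma Finite_Empty_set : Finite Empty_set.
Proof. exists nil; intros []. Qed.

Lemma Pair_finite : FiniteCategory Pair.
Proof.
  split.
  - exists (true :: false :: nil); intros []; simpl; tauto.
  - intros [] []; (exact Finite_unit || exact Finite_Empty_set).
Qed.

Lemma Cospan_finite : FiniteCategory Cospan.
Proof.
  split.
  - exists (left_foot :: right_foot :: peak :: nil); intros []; simpl; tauto.
  - intros [] []; (exact Finite_unit || exact Finite_Empty_set).
Qed.

(** * Binary products and pullbacks as finite limits *)

Section FiniteLimits.

Variables (B : Category) (hfl : has_finite_limits B).

Definition pair_functor (X Y : B) : Functor Pair B.
Proof.
  refine {| fob := fun x : Pair => if (x : bool) then X else Y;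
            fmap := fun x y : Pair => _ |}.
  Unshelve.
  3: destruct x, y; intros []; apply id.
  - intros []; reflexivity.
  - intros [] [] [] [] []; symmetry; apply id_l.
Defined.

Lemma product_exists (X Y : B) : exists (P : B) (p1 : Hom P X) (p2 : Hom P Y),
  forall (K : B) (t1 : Hom K X) (t2 : Hom K Y),
    exists! t : Hom K P, p1 o t = t1 /\ p2 o t = t2.
Proof.
  destruct (hfl (pair_functor X Y) Pair_finite) as [L HL].
  exists (apex L), (@leg _ _ _ L true), (@leg _ _ _ L false); intros K t1 t2.
  assert (Hn : forall (d e : Pair) (a : Hom d e),
      fmap (pair_functor X Y) a o
        (if d as d return Hom K (pair_functor X Y d) then t1 else t2) =
      (if e as e return Hom K (pair_functor X Y e) then t1 else t2))
    by (intros [] [] []; apply id_l).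
  destruct (HL (Build_Cone Hn)) as [t [Ht Hu]].
  exists t; split.
  - split; [exact (Ht true) | exact (Ht false)].
  - intros t' [H1 H2]; apply Hu; intros []; assumption.
Qed.

Definition cospan_functor (X Y Z : B) (a : Hom X Z) (b : Hom Y Z) : Functor Cospan B.
Proof.
  refine {| fob := fun x : Cospan =>
              match x : cospan with left_foot => X | right_foot => Y | peak => Z end;
            fmap := fun x y : Cospan => _ |}.
  Unshelve.
  3: destruct x, y; intros []; first [exact a | exact b | apply id].
  - intros []; reflexivity.
  - intros [] [] [] [] []; symmetry; first [apply id_l | apply id_r].
Defined.

Lemma pullback_exists (X Y Z : B) (a : Hom X Z) (b : Hom Y Z) :
  exists (P : B) (k1 : Hom P X) (k2 : Hom P Y),
    a o k1 = b o k2 /\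
    forall (K : B) (t1 : Hom K X) (t2 : Hom K Y), a o t1 = b o t2 ->
      exists! t : Hom K P, k1 o t = t1 /\ k2 o t = t2.
Proof.
  destruct (hfl (cospan_functor a b) Cospan_finite) as [L HL].
  pose proof (@leg_natural _ _ _ L left_foot peak tt : a o _ = _) as Ha.
  pose proof (@leg_natural _ _ _ L right_foot peak tt : b o _ = _) as Hb.
  exists (apex L), (@leg _ _ _ L left_foot), (@leg _ _ _ L right_foot); split.
  { now rewrite Ha, Hb. }
  intros K t1 t2 Ht12.
  (* The leg at the peak is forced by the other two; [Ht12] makes [a o t1] fit both feet. *)
  set (l := fun d : cospan =>
    match d return Hom K (cospan_functor a b d) with
    | left_foot => t1 | right_foot => t2 | peak => a o t1 end).
  assert (Hn : forall (d e : Cospan) (c : Hom d e), fmap (cospan_functor a b) c o l d = l e).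
  { intros [] [] []; simpl; first [apply id_l | reflexivity | now symmetry]. }
  destruct (HL (Build_Cone Hn)) as [t [Ht Hu]].
  exists t; split.
  - split; [exact (Ht left_foot) | exact (Ht right_foot)].
  - intros t' [H1 H2]; apply Hu; intros []; try assumption.
    simpl; rewrite <- Ha, <- comp_assoc; exact (f_equal (comp a) H1).
Qed.

End FiniteLimits.

(** Yoneda: take [g] to be the image of the identity. Naturality of [fwd] turns restriction of [g]
    along [t] into [fwd x t], and [fwd x] is bijective. *)
Lemma representation_element (C : Category) (F : Presheaf C) (R : Representation F) :
  exists (c : C) (g : F c), forall (x : C) (g' : F x),
    exists! t : @Hom C x c, @fmap _ _ F c x t g = g'.
Proof.
  destruct R as [c [fwd bwd fb bf sq]].
  exists c, (fwd c (@id C c)); intros x g'.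
  assert (H : forall t : @Hom C x c, @fmap _ _ F c x t (fwd c (@id C c)) = fwd x t).
  { intro t.
    transitivity (fwd x (@comp C x c c (@id C c) t)).
    - symmetry; exact (f_equal (fun k => k (@id C c)) (sq c x t)).
    - now rewrite (@id_l C). }
  exists (bwd x g'); split.
  - rewrite H; exact (f_equal (fun k => k g') (fb x)).
  - intros t <-; rewrite H; exact (f_equal (fun k => k t) (bf x)).
Qed.

(** * Universal maps from reindexings of one object to another object *)

Section Fibration.

Variables (E B : Category) (p : Functor E B) (cl : Cleavage p).

Lemma canon_over_base (I J K : B) (s : Hom J I) (t : Hom K J) (s' : Hom K I)
  (e : s o t = s') (X : FibOb p I) : over t (canon cl e X).
Proof. apply factor_over. Qed.

Lemma lift_canon (I J K : B) (s : Hom J I) (t : Hom K J) (s' : Hom K I)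
  (e : s o t = s') (X : FibOb p I) : lift cl s X o canon cl e X = lift cl s' X.
Proof. apply lift_factor. Qed.

(** [K] plays the role of [U(X, Y)]. The equation [s o t = s'] is bound by an existential because
    [canon] takes its proof as an argument. *)
Definition is_universal_map (I J K : B) (X : FibOb p I) (Y : FibOb p J)
  (s : Hom K I) (r : Hom K J) (h : Hom (total (reindex cl s X)) (total Y)) : Prop :=
  over r h /\
  forall (K' : B) (s' : Hom K' I) (r' : Hom K' J)
    (h' : Hom (total (reindex cl s' X)) (total Y)), over r' h' ->
    exists! t : Hom K' K, exists e : s o t = s', r o t = r' /\ h' = h o canon cl e X.

Lemma hom_object_element (hls : LocallySmall cl) (I : B) (X Y : FibOb p I) :
  exists (H : B) (u : Hom H I) (g : @Hom (Fibre p H) (reindex cl u X) (reindex cl u Y)),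
    forall (K : B) (v : Hom K I) (g' : @Hom (Fibre p K) (reindex cl v X) (reindex cl v Y)),
      exists! t : Hom K H, exists e : u o t = v, pull e g = g'.
Proof.
  destruct (representation_element (hls I X Y)) as [[H u] [g Hg]].
  exists H, u, g; intros K v g'.
  destruct (Hg (existT _ K v) g') as [[t e] [Ht Hu]].
  exists t; split.
  - now exists e.
  - intros t' [e' He'].
    exact (f_equal (@proj1_sig _ _) (Hu (exist _ t' e') He')).
Qed.

(** * Transposition of vertical maps [v^*p1^*X -> v^*p2^*Y] into maps [s^*X -> Y] over [p2 o v] *)

Section Transposition.

Variables (I J P : B) (p1 : Hom P I) (p2 : Hom P J) (X : FibOb p I) (Y : FibOb p J).

Lemma reindex_comp_over (K : B) (v : Hom K P) (s : Hom K I) (e : p1 o v = s) :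
  over (X := reindex cl s X) (Y := reindex cl p1 X) (v o id K) (canon cl e X).
Proof. rewrite id_r; apply canon_over_base. Qed.

(** The cleavage is not assumed split, so [s^*X] and [v^*p1^*X] are compared by a canonical
    isomorphism rather than equated. *)
Definition reindex_comp (K : B) (v : Hom K P) (s : Hom K I) (e : p1 o v = s) :
  Hom (total (reindex cl s X)) (total (reindex cl v (reindex cl p1 X))) :=
  factor cl (reindex_comp_over e).

(** Both objects are cartesian over [X] along [s]; the inverse factors the composite of the lifts of
    [v] and [p1] through the lift of [s]. *)
Lemma reindex_comp_iso (K : B) (v : Hom K P) (s : Hom K I) (e : p1 o v = s) :
  exists k : Hom (total (reindex cl v (reindex cl p1 X))) (total (reindex cl s X)),
    over (id K) k /\ reindex_comp e o k = id _ /\ k o reindex_comp e = id _.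
Proof.
  assert (Hg : over (X := reindex cl v (reindex cl p1 X)) (Y := X) (s o id K)
                 (lift cl p1 X o lift cl v (reindex cl p1 X))).
  { rewrite id_r, <- e; eapply over_comp; apply lift_over. }
  exists (factor cl Hg); split; [apply factor_over | split].
  - apply lift_cancel with (t := id K).
    + eapply over_vert_l; apply factor_over.
    + apply over_id.
    + unfold reindex_comp; rewrite comp_assoc, lift_factor, id_r.
      apply lift_cancel with (t := v).
      * eapply over_vert_r; [apply canon_over_base | apply factor_over].
      * apply lift_over.
      * rewrite comp_assoc, lift_canon; apply lift_factor.
  - apply lift_cancel with (t := id K).
    + eapply over_vert_l; apply factor_over.
    + apply over_id.
    + rewrite comp_assoc, lift_factor, id_r, <- comp_assoc.
      unfold reindex_comp; rewrite lift_factor; apply lift_canon.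
Qed.

Definition transpose (K : B) (v : Hom K P) (s : Hom K I) (e : p1 o v = s)
  (g : @Hom (Fibre p K) (reindex cl v (reindex cl p1 X)) (reindex cl v (reindex cl p2 Y))) :
  Hom (total (reindex cl s X)) (total Y) :=
  lift cl p2 Y o (lift cl v (reindex cl p2 Y) o (proj1_sig g o reindex_comp e)).

Lemma transpose_over (K : B) (v : Hom K P) (s : Hom K I) (e : p1 o v = s)
  (g : @Hom (Fibre p K) (reindex cl v (reindex cl p1 X)) (reindex cl v (reindex cl p2 Y))) :
  over (p2 o v) (transpose e g).
Proof.
  eapply over_comp; [apply lift_over |].
  eapply over_vert_r; [apply lift_over |].
  eapply over_vert_l; [exact (proj2_sig g) | apply factor_over].
Qed.

(** Precomposition with [reindex_comp e] is invertible, and a map over [p2 o v] factors uniquely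
    through the lift of [p2] and then that of [v]. *)
Lemma transpose_bij (K : B) (v : Hom K P) (s : Hom K I) (e : p1 o v = s)
  (h : Hom (total (reindex cl s X)) (total Y)) :
  over (p2 o v) h -> exists! g, transpose e g = h.
Proof.
  intro Hh.
  destruct (reindex_comp_iso e) as [k [Hk [Hk1 Hk2]]].
  assert (H1 : over (X := reindex cl v (reindex cl p1 X)) (Y := Y) (p2 o v) (h o k))
    by (eapply over_vert_r; eassumption).
  assert (H2 : over (X := reindex cl v (reindex cl p1 X)) (Y := reindex cl p2 Y)
                 (v o id K) (factor cl H1))
    by (rewrite id_r; apply factor_over).
  exists (exist _ (factor cl H2) (factor_over cl H2)); split.
  - unfold transpose; simpl.
    rewrite (comp_assoc (lift cl v _)), lift_factor, comp_assoc, lift_factor.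
    now rewrite <- comp_assoc, Hk2, id_r.
  - intros g Hg; apply sig_ext; simpl.
    apply lift_cancel with (t := id K); [apply factor_over | exact (proj2_sig g) |].
    rewrite lift_factor.
    apply lift_cancel with (t := v); [apply factor_over | |].
    { eapply over_vert_r; [apply lift_over | exact (proj2_sig g)]. }
    rewrite lift_factor, <- Hg; unfold transpose.
    now rewrite <- !comp_assoc, Hk1, id_r.
Qed.

(** Naturality of transposition in the base, which carries a universal element of the hom presheaf
    to a universal map. It reduces to compatibility of [reindex_comp] with [canon] ([Hc]) and to
    [pull_spec]. *)
Lemma transpose_pull (K L : B) (v : Hom K P) (t : Hom L K) (v' : Hom L P)
  (s : Hom K I) (s' : Hom L I) (e : p1 o v = s) (e' : p1 o v' = s')
  (ev : v o t = v') (es : s o t = s')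
  (g : @Hom (Fibre p K) (reindex cl v (reindex cl p1 X)) (reindex cl v (reindex cl p2 Y))) :
  transpose e' (pull ev g) = transpose e g o canon cl es X.
Proof.
  assert (Hc : canon cl ev (reindex cl p1 X) o reindex_comp e' =
               reindex_comp e o canon cl es X).
  { apply lift_cancel with (t := t).
    - eapply over_vert_r; [apply canon_over_base | apply factor_over].
    - eapply over_vert_l; [apply factor_over | apply canon_over_base].
    - unfold reindex_comp.
      rewrite !comp_assoc, lift_canon, !lift_factor.
      apply lift_cancel with (t := v').
      + apply canon_over_base.
      + rewrite <- ev; eapply over_comp; apply canon_over_base.
      + now rewrite comp_assoc, !lift_canon. }
  unfold transpose.
  rewrite <- (lift_canon ev), <- !comp_assoc, <- Hc.
  do 2 f_equal.
  rewrite comp_assoc, pull_spec; symmetry; apply comp_assoc.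
Qed.

End Transposition.

Lemma universal_map_exists (hls : LocallySmall cl) (hfl : has_finite_limits B)
  (I J : B) (X : FibOb p I) (Y : FibOb p J) :
  exists (K : B) (s : Hom K I) (r : Hom K J) (h : Hom (total (reindex cl s X)) (total Y)),
    is_universal_map r h.
Proof.
  destruct (product_exists hfl I J) as [P [p1 [p2 HP]]].
  destruct (hom_object_element hls (reindex cl p1 X) (reindex cl p2 Y)) as [H [u [g Hg]]].
  exists H, (p1 o u), (p2 o u), (transpose eq_refl g); split.
  { apply transpose_over. }
  intros K s r h Hh.
  (* The pair [s], [r] becomes one map [v] into the product; [h] then transposes to a vertical map
     [g'], which the hom object classifies. *)
  destruct (HP K s r) as [v [[Hv1 Hv2] Hvu]]; subst r.
  destruct (transpose_bij Hv1 Hh) as [g' [Hg' Hgu]].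
  destruct (Hg K v g') as [t [[et Ht] Htu]].
  exists t; split.
  - assert (es : (p1 o u) o t = s) by (now rewrite <- comp_assoc, et).
    exists es; split.
    + now rewrite <- comp_assoc, et.
    + now rewrite <- (transpose_pull eq_refl Hv1 et es), Ht.
  - intros t' [es [er eh]]; apply Htu.
    (* [es] and [er] fix the two projections of [u o t'], so uniqueness of pairing applies. *)
    assert (et' : u o t' = v).
    { symmetry; apply Hvu; split; now rewrite comp_assoc. }
    exists et'; symmetry; apply Hgu.
    rewrite (transpose_pull eq_refl Hv1 et' es); now symmetry.
Qed.

(** Both maps classify [h o canon cl e X], so the uniqueness half of universality identifies
    them. *)
Lemma universal_map_cancel (I J K L : B) (X : FibOb p I) (Y : FibOb p J)
  (s : Hom K I) (r : Hom K J) (h : Hom (total (reindex cl s X)) (total Y))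
  (t t' : Hom L K) (s' : Hom L I) (e : s o t = s') (e' : s o t' = s') :
  is_universal_map r h -> r o t = r o t' ->
  h o canon cl e X = h o canon cl e' X -> t = t'.
Proof.
  intros [Hh Hu] er eh.
  assert (Ho : over (X := reindex cl s' X) (Y := Y) (r o t) (h o canon cl e X))
    by (eapply over_comp; [exact Hh | apply canon_over_base]).
  destruct (Hu L s' (r o t) _ Ho) as [a [_ Ha]].
  transitivity a; [symmetry |]; apply Ha.
  - now exists e.
  - exists e'; now split.
Qed.

Lemma canon_eq (I K L : B) (s : Hom K I) (t t' : Hom L K) (s' : Hom L I)
  (e : s o t = s') (e' : s o t' = s') (X : FibOb p I) :
  t = t' -> canon cl e X = canon cl e' X.
Proof. intro H; revert e; rewrite H; intro e; now rewrite (proof_irrelevance _ e e'). Qed.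

(* [vtgt (vreindex cl s m)] and [reindex cl s (vtgt m)] have the same total object but carry
   different proofs that it lies over the base. *)
Lemma over_irrelevant (I J : B) (X Y : E) (eX eX' : p X = I) (eY eY' : p Y = J)
  (u : Hom I J) (f : Hom X Y) :
  hom_cast eX eY (fmap p f) = u -> hom_cast eX' eY' (fmap p f) = u.
Proof.
  now rewrite (proof_irrelevance _ eX' eX), (proof_irrelevance _ eY' eY).
Qed.

(** * Domain and codomain components of canonical maps in [Vert] *)

Lemma hsrc_canon (I J K : B) (s : Hom J I) (t : Hom K J) (s' : Hom K I)
  (e : s o t = s') (m : FibOb (vert_proj p) I) :
  hsrc (canon (vert_cleavage cl) e m) = canon cl e (vsrc m).
Proof.
  apply (lift_cancel (cl := cl) (u := s) (t := t) (Y := vsrc m) (Z := reindex cl s' (vsrc m))).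
  - exact (factor_over (vert_cleavage cl) (canon_over (vert_cleavage cl) e m)).
  - apply canon_over_base.
  - rewrite lift_canon.
    exact (f_equal (@hsrc _ _ _) (lift_factor (vert_cleavage cl) (canon_over (vert_cleavage cl) e m))).
Qed.

Lemma htgt_canon (I J K : B) (s : Hom J I) (t : Hom K J) (s' : Hom K I)
  (e : s o t = s') (m : FibOb (vert_proj p) I) :
  htgt (canon (vert_cleavage cl) e m) = canon cl e (vtgt m).
Proof.
  apply (lift_cancel (cl := cl) (u := s) (t := t) (Y := vtgt m) (Z := reindex cl s' (vtgt m))).
  - exact (over_irrelevant _ _
      (vert_hom_over (factor_over (vert_cleavage cl) (canon_over (vert_cleavage cl) e m)))).
  - apply canon_over_base.
  - rewrite lift_canon.
    exact (f_equal (@htgt _ _ _) (lift_factor (vert_cleavage cl) (canon_over (vert_cleavage cl) e m))).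
Qed.

(** Typed to end in [reindex cl s (vtgt m)] rather than [vtgt (vreindex cl s m)], whose proof of
    lying over [K] differs. *)
Definition reindexed_arr (I K : B) (s : Hom K I) (m : FibOb (vert_proj p) I) :
  Hom (total (reindex cl s (vsrc m))) (total (reindex cl s (vtgt m))) :=
  varr (vreindex cl s m).

Lemma reindexed_arr_over (I K : B) (s : Hom K I) (m : FibOb (vert_proj p) I) :
  over (X := reindex cl s (vsrc m)) (Y := reindex cl s (vtgt m)) (id K) (reindexed_arr s m).
Proof. apply factor_over. Qed.

Lemma reindexed_arr_canon (I J K : B) (s : Hom J I) (t : Hom K J) (s' : Hom K I)
  (e : s o t = s') (m : FibOb (vert_proj p) I) :
  reindexed_arr s m o canon cl e (vsrc m) = canon cl e (vtgt m) o reindexed_arr s' m.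
Proof.
  rewrite <- hsrc_canon, <- htgt_canon; exact (hsq (canon (vert_cleavage cl) e m)).
Qed.

End Fibration.

Theorem proposition3p2p4 (E B : Category) (p : Functor E B) (cl : Cleavage p)
  (hls : LocallySmall cl) (hfl : has_finite_limits B)
  (I J : B) (m : FibOb (vert_proj p) I) (f : FibOb (vert_proj p) J) :
  exists U : LiftingFamily cl m f, is_universal_family U.
Proof.
  destruct (universal_map_exists hls hfl (vsrc m) (vsrc f)) as [U0 [s0 [r0 [h0 H0]]]].
  destruct (universal_map_exists hls hfl (vtgt m) (vtgt f)) as [U1 [s1 [r1 [h1 H1]]]].
  destruct (universal_map_exists hls hfl (vsrc m) (vtgt f)) as [U2 [s2 [r2 [h2 H2]]]].
  assert (Ho0 : over (X := reindex cl s0 (vsrc m)) (Y := vtgt f) r0 (varr f o h0))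
    by (eapply over_vert_l; [apply varr_over | apply H0]).
  assert (Ho1 : over (X := reindex cl s1 (vsrc m)) (Y := vtgt f) r1 (h1 o reindexed_arr cl s1 m))
    by (eapply over_vert_r; [apply H1 | apply reindexed_arr_over]).
  (* [a] and [b] form the cospan: they classify [h0] followed by [f], and the reindexed [m] followed
     by [h1]. *)
  destruct (proj2 H2 _ _ _ _ Ho0) as [a [[ea [era eha]] _]].
  destruct (proj2 H2 _ _ _ _ Ho1) as [b [[eb [erb ehb]] _]].
  destruct (pullback_exists hfl a b) as [P [k0 [k1 [Hk HP]]]].
  (* The base maps agree along both legs because each factors through the base of [h2], where [Hk]
     applies; [s] and [r] can thus be defined through [k0]. *)
  assert (e1 : s1 o k1 = s0 o k0)
    by (rewrite <- ea, <- eb, <- !comp_assoc; now f_equal).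
  assert (er1 : r1 o k1 = r0 o k0)
    by (rewrite <- era, <- erb, <- !comp_assoc; now f_equal).
  set (s := s0 o k0) in *; set (r := r0 o k0) in *.
  assert (e0 : s0 o k0 = s) by reflexivity.
  (* Both sides are restrictions of [h2], along [a o k0] and [b o k1], equal by [Hk]. *)
  assert (Hsq : varr f o (h0 o canon cl e0 (vsrc m)) =
                h1 o canon cl e1 (vtgt m) o reindexed_arr cl s m).
  { assert (ea' : s2 o (a o k0) = s) by (now rewrite comp_assoc, ea).
    assert (eb' : s2 o (b o k1) = s) by (now rewrite comp_assoc, eb).
    rewrite comp_assoc, eha, <- !comp_assoc, <- reindexed_arr_canon, (comp_assoc h1), ehb.
    rewrite <- !comp_assoc, <- (canon_comp cl ea e0 ea'), <- (canon_comp cl eb e1 eb').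
    f_equal; now apply canon_eq. }
  (* Lying over [r] is a condition on the domain component, as [vert_proj] is [p] after [dom]. *)
  assert (Hr : over (X := reindex cl s (vsrc m)) (Y := vsrc f) r (h0 o canon cl e0 (vsrc m)))
    by (eapply over_comp; [apply H0 | apply canon_over_base]).
  pose (h := {| hsrc := h0 o canon cl e0 (vsrc m) :
                  Hom (src (proj1_sig (total (vreindex cl s m)))) (src (proj1_sig (total f)));
                htgt := h1 o canon cl e1 (vtgt m) :
                  Hom (tgt (proj1_sig (total (vreindex cl s m)))) (tgt (proj1_sig (total f)));
                hsq := Hsq |} : Hom (total (vreindex cl s m)) (total f)).
  exists (@Build_LiftingFamily _ _ _ cl _ _ m f P s r h Hr).
  intros [K s' r' g Hg]; cbn [lf_base lf_left lf_right lf_map].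
  destruct (proj2 H0 K s' r' (hsrc g) Hg) as [t0 [[et0 [ert0 eht0]] Hu0]].
  destruct (proj2 H1 K s' r' (htgt g) (over_irrelevant _ _ (vert_hom_over Hg)))
    as [t1 [[et1 [ert1 eht1]] Hu1]].
  (* The two sides classify the two composites of the square [g], which are equal. *)
  assert (Ht : a o t0 = b o t1).
  { assert (ea' : s2 o (a o t0) = s') by (now rewrite comp_assoc, ea).
    assert (eb' : s2 o (b o t1) = s') by (now rewrite comp_assoc, eb).
    apply (universal_map_cancel (e := ea') (e' := eb') H2).
    - now rewrite !comp_assoc, era, erb, ert0.
    - rewrite (canon_comp cl ea et0 ea'), (canon_comp cl eb et1 eb'), !comp_assoc, <- eha, <- ehb.
      rewrite <- !comp_assoc, reindexed_arr_canon, <- eht0, (comp_assoc h1), <- eht1.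
      exact (hsq g). }
  destruct (HP K t0 t1 Ht) as [t [[Ht0 Ht1] Htu]].
  (* Stated for arbitrary [t'] to serve both existence and uniqueness: the equation in [Vert] splits
     into the conditions that characterise [t0] and [t1]. *)
  assert (Hmap : forall (t' : Hom K P) (e : s o t' = s') (e0' : s0 o (k0 o t') = s')
      (e1' : s1 o (k1 o t') = s'),
    g = h o canon (vert_cleavage cl) e m <->
    hsrc g = h0 o canon cl e0' (vsrc m) /\ htgt g = h1 o canon cl e1' (vtgt m)).
  { intros t' e e0' e1'.
    rewrite (canon_comp cl e0 e e0'), (canon_comp cl e1 e e1'), !comp_assoc.
    rewrite <- (hsrc_canon cl e), <- (htgt_canon cl e).
    split; [now intros -> | intros [? ?]; now apply ArrHom_ext]. }
  exists t; split.
  - assert (e : s o t = s') by (unfold s; now rewrite <- comp_assoc, Ht0).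
    exists e; split.
    { unfold r; now rewrite <- comp_assoc, Ht0. }
    subst t0 t1; now apply (Hmap t e et0 et1).
  - intros t' [e [er Hgt]].
    assert (e0' : s0 o (k0 o t') = s') by (now rewrite comp_assoc).
    assert (e1' : s1 o (k1 o t') = s') by (now rewrite comp_assoc, e1).
    apply (Hmap t' e e0' e1') in Hgt; destruct Hgt as [Hg0 Hg1].
    apply Htu; split; symmetry.
    + apply Hu0; exists e0'; split; [now rewrite comp_assoc | exact Hg0].
    + apply Hu1; exists e1'; split; [now rewrite comp_assoc, er1 | exact Hg1].
Qed.
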